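(* Let $MPR_{lsd}\subset MPR$ be the subgroup spanned by the lsd permutation words (including the empty word). Then $MPR_{lsd}$ is a subcoalgebra of $(MPR,\mu)$, and the restriction $\pi''=\pi|_{MPR_{lsd}}:MPR_{lsd}\to QSymm$ is an isomorphism of coalgebras. Consequently $(\pi'')^{-1}:QSymm\to MPR_{lsd}\subset MPR$ is a coalgebra morphism with $\pi\circ(\pi'')^{-1}=\mathrm{id}_{QSymm}$, i.e. a coalgebra section of $\pi$.
   Context: A permutation word of length $n$ is a word $[s_1,\dots,s_n]$ over $\mathbf N$ in which each of $1,\dots,n$ occurs once; $S_n$ is the set of these. $\mathrm{desc}(\sigma)=\{i\in\{1,\dots,n-1\}:s_i>s_{i+1}\}$. $\sigma\in S_n$ is lsd if it is the lexicographically smallest element of $\{\tau\in S_n:\mathrm{desc}(\tau)=\mathrm{desc}(\sigma)\}$. For a word $\alpha$ over $\mathbf N$ without repeated letters, $\mathrm{st}(\alpha)$ relabels its letters by $1,\dots,\text{length}$ via the order-preserving bijection. $(MPR,m,\mu)$: free abelian group on all permutation words; $m([a_1,\dots,a_m]\otimes[b_1,\dots,b_n])=[a_1,\dots,a_m]\times_{sh}[m+b_1,\dots,m+b_n]$ (shuffle product); $\mu(\alpha)=\sum_{\alpha'*\alpha''=\alpha}\mathrm{st}(\alpha')\otimes\mathrm{st}(\alpha'')$ over all prefix/suffix cuts; counit $1$ on the empty word, $0$ elsewhere. A composition of $n$ is a word $[a_1,\dots,a_r]$ over $\mathbf N$ with sum $n$; for $D=\{d_1<\dots<d_{r-1}\}\subset\{1,\dots,n-1\}$,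 $\mathrm{comp}(D)=[d_1,d_2-d_1,\dots,n-d_{r-1}]$. $QSymm$ is the free abelian group on all compositions (words over $\mathbf N$, including the empty one), with comultiplication $\mu([a_1,\dots,a_m])=\sum_{i=0}^m[a_1,\dots,a_i]\otimes[a_{i+1},\dots,a_m]$, counit $1$ on the empty word and $0$ elsewhere (and the overlapping shuffle product as multiplication). For compositions, $\beta\ge\alpha$ means $\beta$ refines $\alpha$; $F_\alpha=\sum_{\beta\ge\alpha}\beta$; the $F_\alpha$ form a basis of $QSymm$. The map $\pi:(MPR,m,\mu)\to QSymm$, $\pi(\sigma)=F_{\mathrm{comp}(\mathrm{desc}(\sigma))}$, is a surjective Hopf algebra morphism (in particular a coalgebra morphism). *)

(* Defs.v *)
From HB Require Import structures.
From mathcomp Require Import all_boot all_order all_algebra.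
From mathcomp Require Import freeg.
Set Implicit Arguments. Unset Strict Implicit. Unset Printing Implicit Defensive.
Import Order.TTheory GRing.Theory Num.Theory.
Local Open Scope ring_scope.

Notation word := (seq nat).

Definition is_permword (s : word) : bool := perm_eq s (iota 1 (size s)).

(** desc(s) = { i in 1..n-1 : s_i > s_{i+1} } (1-indexed), as a sorted list *)
Definition desc (s : word) : seq nat :=
  [seq i <- iota 1 (size s).-1 | (nth 0 s i < nth 0 s i.-1)%N].

Fixpoint lexle (s t : word) : bool :=
  match s, t with
  | [::], _ => true
  | _ :: _, [::] => false
  | x :: s', y :: t' => (x < y)%N || ((x == y) && lexle s' t')
  end.

Definition lsd (s : word) : bool :=
  is_permword s &&
  all (fun t => (desc t == desc s) ==> lexle s t) (permutations (iota 1 (size s))).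

(** standardization: relabel by the order-preserving bijection onto 1..length *)
Definition st (a : word) : word := [seq count (fun y => (y <= x)%N) a | x <- a].

(** Free abelian groups: the free abelian group on all words; MPR is the
    subgroup of elements supported on permutation words, QSymm the subgroup
    supported on compositions.  Tensor products of free abelian groups are
    identified with the free abelian group on pairs of basis elements. *)
Definition FA := {freeg word / int}.
Definition FA2 := {freeg (word * word)%type / int}.

Definition tens (x y : FA) : FA2 :=
  fglift (fun a : word => fglift (fun b : word => << (a, b) >> : FA2) y) x.

Definition muM_basis (w : word) : FA2 :=
  \sum_(i <- iota 0 (size w).+1) << (st (take i w), st (drop i w)) >>.
Definition muM (x : FA) : FA2 := fglift muM_basis x.

Definition eps (x : FA) : int :=
  fglift (fun w : word => ((w == [::])%:R : int^o)) x.

Definition DeltaQ_basis (c : word) : FA2 :=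
  \sum_(i <- iota 0 (size c).+1) << (take i c, drop i c) >>.
Definition DeltaQ (x : FA) : FA2 := fglift DeltaQ_basis x.

Definition is_comp (c : word) : bool := all (fun k => (0 < k)%N) c.

(** comp(D) for D = {d_1 < ... < d_{r-1}} subset of {1..n-1} (sorted list);
    the empty composition when n = 0 *)
Definition comp (n : nat) (D : seq nat) : word :=
  if n is 0 then [::] else [seq (p.2 - p.1)%N | p <- zip (0 :: D) (rcons D n)].

Definition psums (c : word) : seq nat := [seq sumn (take i c) | i <- iota 1 (size c)].

Definition refines (beta alpha : word) : bool :=
  (sumn beta == sumn alpha) && all (fun d => d \in psums beta) (psums alpha).

Fixpoint sublists (s : seq nat) : seq (seq nat) :=
  match s with
  | [::] => [:: [::]]
  | x :: s' => sublists s' ++ map (cons x) (sublists s')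
  end.

(** F_alpha = sum of all compositions beta refining alpha; the compositions of
    n are enumerated (bijectively) as comp n D for D subset of {1..n-1}. *)
Definition Ffun (alpha : word) : FA :=
  let n := sumn alpha in
  \sum_(D <- sublists (iota 1 n.-1) | refines (comp n D) alpha) << comp n D >>.

Definition pi_basis (s : word) : FA := Ffun (comp (size s) (desc s)).
Definition piM (x : FA) : FA := fglift pi_basis x.
Definition pipi (z : FA2) : FA2 :=
  fglift (fun p : word * word => tens (pi_basis p.1) (pi_basis p.2)) z.

Definition tens_map (f : FA -> FA) (z : FA2) : FA2 :=
  fglift (fun p : word * word => tens (f << p.1 >>) (f << p.2 >>)) z.

Definition in_MPRlsd (x : FA) : bool := all lsd (dom x).
Definition in_MPRlsd2 (z : FA2) : bool := all (fun p => lsd p.1 && lsd p.2) (dom z).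
Definition in_QSymm (y : FA) : bool := all is_comp (dom y).

(* Main.v *)
(* Words over {ascent, descent}, coded by [seq bool], index nonempty
   compositions; in this indexing F is the zeta transform of the basis of
   compositions for the bitwise order, so Moebius inversion gives an explicit
   inverse of pi''.  The lsd words are exactly the layered permutation words:
   an inversion of a layered word forces descents at all positions in between,
   hence it is an inversion of every word with the same descents, and inclusion
   of inversion sets implies the lexicographic order.  Being layered is a
   condition on comparisons between letters, so it passes to standardized
   prefixes and suffixes. *)

Require Import Defs.
From HB Require Import structures.
From mathcomp Require Import all_boot all_order all_algebra.
From mathcomp Require Import freeg.
From mathcomp Require Import zify.
Import GRing.Theory.
Set Implicit Arguments. Unset Strict Implicit. Unset Printing Implicit Defensive.
Local Open Scope ring_scope.

(** * Free abelian groups *)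

HB.instance Definition _ (R : nzRingType) (K : choiceType) (M : lmodType R)
  (f : K -> M) :=
  GRing.isZmodMorphism.Build {freeg K / R} M (fglift f) (lift_is_additive f).

Lemma fgliftE (R : nzRingType) (K : choiceType) (M : lmodType R) (f : K -> M)
    (x : {freeg K / R}) :
  fglift f x = \sum_(z <- dom x) coeff z x *: f z.
Proof.
by rewrite -{1}[x]freeg_sumE raddf_sum; apply: eq_bigr => z _; rewrite /= liftU.
Qed.

Lemma fglift1 (R : nzRingType) (K : choiceType) (M : lmodType R) (f : K -> M) z :
  fglift f << z >> = f z.
Proof. by rewrite liftU scale1r. Qed.

Lemma eq_fglift_dom (R : nzRingType) (K : choiceType) (M : lmodType R)
    (f g : K -> M) (x : {freeg K / R}) :
  {in dom x, f =1 g} -> fglift f x = fglift g x.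
Proof.
by move=> fg; rewrite !fgliftE; apply: eq_big_seq => z /fg ->.
Qed.

Lemma fgliftB_fun (R : nzRingType) (K : choiceType) (M : lmodType R)
    (f g : K -> M) (x : {freeg K / R}) :
  fglift (fun z => f z - g z) x = fglift f x - fglift g x.
Proof.
by rewrite !fgliftE -sumrB; apply: eq_bigr => z _; rewrite scalerBr.
Qed.

(** Integer coefficients act as repeated addition, so additivity of [h] alone lets it pass through
    the linear extension. This reduces identities between additive maps to basis elements. *)
Lemma raddf_fglift (K : choiceType) (M N : lmodType int)
    (h : {additive M -> N}) (f : K -> M) (x : {freeg K / int}) :
  h (fglift f x) = fglift (fun z => h (f z)) x.
Proof.
rewrite !fgliftE raddf_sum; apply: eq_bigr => z _.
by rewrite -[coeff z x]intz !scaler_int raddfMz.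
Qed.

Lemma fglift_id (K : choiceType) (x : {freeg K / int}) :
  fglift (fun z => << z >> : {freeg K / int}) x = x.
Proof.
rewrite fgliftE -[RHS]freeg_sumE; apply: eq_bigr => z _.
by apply/eqP/freeg_eqP => y; rewrite coeffZ !coeffU mul1r.
Qed.

(** The common form of [in_MPRlsd], [in_MPRlsd2] and [in_QSymm], which are instances of it by
    conversion. *)
Definition supported (K : choiceType) (P : pred K) (x : {freeg K / int}) :=
  all P (dom x).

Lemma supported1 (K : choiceType) (P : pred K) z :
  supported P << z >> = P z.
Proof. by rewrite /supported domU1 /= andbT. Qed.

Lemma supportedB (K : choiceType) (P : pred K) (x y : {freeg K / int}) :
  supported P x -> supported P y -> supported P (x - y).
Proof.
move=> /allP Px /allP Py; apply/allP => z /domB.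
by rewrite mem_cat => /orP[/Px|/Py].
Qed.

Lemma supportedD (K : choiceType) (P : pred K) (x y : {freeg K / int}) :
  supported P x -> supported P y -> supported P (x + y).
Proof.
move=> /allP Px /allP Py; apply/allP => z /domD_subset.
by rewrite mem_cat => /orP[/Px|/Py].
Qed.

Lemma supported_sum (K : choiceType) (P : pred K) (I : eqType) (r : seq I)
    (F : I -> {freeg K / int}) :
  {in r, forall i, supported P (F i)} -> supported P (\sum_(i <- r) F i).
Proof.
move=> PF; rewrite big_seq; apply: (big_ind (@supported K P)) => //.
  by rewrite /supported dom0.
by move=> x y; apply: supportedD.
Qed.

Lemma supported_fglift (K L : choiceType) (P : pred L)
    (f : K -> {freeg L / int}) (x : {freeg K / int}) :
  {in dom x, forall z, supported P (f z)} -> supported P (fglift f x).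
Proof.
move=> Pf; rewrite fgliftE; apply: supported_sum => z /Pf /allP Pz.
by apply/allP => y /domZ_subset /Pz.
Qed.

HB.instance Definition _ :=
  GRing.isZmodMorphism.Build FA FA piM (lift_is_additive pi_basis).
HB.instance Definition _ :=
  GRing.isZmodMorphism.Build FA FA2 DeltaQ (lift_is_additive DeltaQ_basis).
HB.instance Definition _ := GRing.isZmodMorphism.Build FA int^o eps
  (lift_is_additive (fun w : word => ((w == [::])%:R : int^o))).
HB.instance Definition _ := GRing.isZmodMorphism.Build FA2 FA2 pipi
  (lift_is_additive (fun p : word * word => tens (pi_basis p.1) (pi_basis p.2))).
HB.instance Definition _ (f : FA -> FA) := GRing.isZmodMorphism.Build FA2 FA2 (tens_map f)
  (lift_is_additive (fun p : word * word => tens (f << p.1 >>) (f << p.2 >>))).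

Lemma tensBr (x y z : FA) : tens x (y - z) = tens x y - tens x z.
Proof.
by rewrite /tens -fgliftB_fun; apply: eq_fglift_dom => a _; rewrite raddfB.
Qed.

HB.instance Definition _ (x : FA) :=
  GRing.isZmodMorphism.Build FA FA2 (tens x) (tensBr x).

(** With the left factor as last argument, additivity in that factor can also be registered as a
    structure. *)
Definition tensr (y x : FA) : FA2 := tens x y.

HB.instance Definition _ (y : FA) := GRing.isZmodMorphism.Build FA FA2 (tensr y)
  (lift_is_additive (fun a : word => fglift (fun b : word => << (a, b) >> : FA2) y)).

Lemma tens1 (a b : word) : tens << a >> << b >> = << (a, b) >>.
Proof. by rewrite /tens !fglift1. Qed.

Lemma tens_map_tens (f : {additive FA -> FA}) (x y : FA) :
  tens_map f (tens x y) = tens (f x) (f y).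
Proof.
rewrite -{2}[x]fglift_id -{2}[y]fglift_id !(raddf_fglift f).
rewrite [LHS](raddf_fglift (tens_map f)) [RHS](raddf_fglift (tensr _)).
apply: eq_fglift_dom => a _; rewrite (raddf_fglift (tens_map f)).
rewrite [RHS](raddf_fglift (tens (f << a >>))); apply: eq_fglift_dom => b _.
by rewrite /= /tens_map fglift1.
Qed.

(** * Zeta and Moebius transforms on bit sequences *)

(** Recursion on the bits treats one coordinate of the Boolean lattice at a time; identities then
    follow by induction on [b] with [g] generalised. The closed form as a sum is [zetaE]. *)
Fixpoint zeta (V : zmodType) (g : seq bool -> V) (b : seq bool) : V :=
  match b with
  | [::] => g [::]
  | true :: b' => zeta (fun c => g (true :: c)) b'
  | false :: b' =>
      zeta (fun c => g (false :: c)) b' + zeta (fun c => g (true :: c)) b'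
  end.

Fixpoint moebius (V : zmodType) (g : seq bool -> V) (b : seq bool) : V :=
  match b with
  | [::] => g [::]
  | true :: b' => moebius (fun c => g (true :: c)) b'
  | false :: b' =>
      moebius (fun c => g (false :: c)) b' - moebius (fun c => g (true :: c)) b'
  end.

Lemma eq_zeta (V : zmodType) (g h : seq bool -> V) :
  g =1 h -> zeta g =1 zeta h.
Proof.
move=> gh b; elim: b g h gh => [|[] b IH] g h gh /=; first exact: gh.
  by apply: IH => c; apply: gh.
by congr (_ + _); apply: IH => c; apply: gh.
Qed.

Lemma eq_moebius (V : zmodType) (g h : seq bool -> V) :
  g =1 h -> moebius g =1 moebius h.
Proof.
move=> gh b; elim: b g h gh => [|[] b IH] g h gh /=; first exact: gh.
  by apply: IH => c; apply: gh.
by congr (_ - _); apply: IH => c; apply: gh.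
Qed.

Lemma raddf_zeta (U V : zmodType) (f : {additive U -> V}) g b :
  f (zeta g b) = zeta (fun c => f (g c)) b.
Proof. by elim: b g => [|[] b IH] g //=; rewrite raddfD /= !IH. Qed.

Lemma raddf_moebius (U V : zmodType) (f : {additive U -> V}) g b :
  f (moebius g b) = moebius (fun c => f (g c)) b.
Proof. by elim: b g => [|[] b IH] g //=; rewrite raddfB /= !IH. Qed.

Lemma zetaD (V : zmodType) (g h : seq bool -> V) b :
  zeta (fun c => g c + h c) b = zeta g b + zeta h b.
Proof. by elim: b g h => [|[] b IH] g h //=; rewrite !IH addrACA. Qed.

Lemma zetaB (V : zmodType) (g h : seq bool -> V) b :
  zeta (fun c => g c - h c) b = zeta g b - zeta h b.
Proof.
by elim: b g h => [|[] b IH] g h //=; rewrite !IH opprD addrACA.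
Qed.

Lemma moebiusD (V : zmodType) (g h : seq bool -> V) b :
  moebius (fun c => g c + h c) b = moebius g b + moebius h b.
Proof.
by elim: b g h => [|[] b IH] g h //=; rewrite !IH opprD addrACA.
Qed.

Lemma zeta_moebius (V : zmodType) (g : seq bool -> V) b :
  zeta (moebius g) b = g b.
Proof.
elim: b g => [|[] b IH] g //=.
rewrite zetaB -[RHS](IH (fun c => g (false :: c))).
by rewrite -[X in _ - X + _]/(zeta (moebius (fun c => g (true :: c))) b) subrK.
Qed.

Lemma moebius_zeta (V : zmodType) (g : seq bool -> V) b :
  moebius (zeta g) b = g b.
Proof.
elim: b g => [|[] b IH] g //=.
by rewrite moebiusD addrK; apply: (IH (fun c => g (false :: c))).
Qed.

(** * Cuts of bit sequences and deconcatenation of compositions *)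

Fixpoint true_cuts (V : zmodType) (h : seq bool -> seq bool -> V) b : V :=
  match b with
  | [::] => 0
  | true :: b' => h [::] b' + true_cuts (fun u => h (true :: u)) b'
  | false :: b' => true_cuts (fun u => h (false :: u)) b'
  end.

(** Both kinds of cut delete the bit at which they are made. A composition can be cut only between
    two parts, at a [true] bit; a permutation word can be cut between any two letters, and the
    comparison of these two letters is lost. *)
Fixpoint all_cuts (V : zmodType) (h : seq bool -> seq bool -> V) b : V :=
  if b is x :: b' then h [::] b' + all_cuts (fun u => h (x :: u)) b' else 0.

Lemma all_cutsD (V : zmodType) (h k : seq bool -> seq bool -> V) b :
  all_cuts (fun u v => h u v + k u v) b = all_cuts h b + all_cuts k b.
Proof.
elim: b h k => [|x b IH] h k /=; first by rewrite addr0.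
by rewrite (IH (fun u => h (x :: u)) (fun u => k (x :: u))) addrACA.
Qed.

(** The combinatorial core of the compatibility of [pi] with comultiplication. Choose some [c] above
    [b] and a [true] bit of [c]: the bit of [b] at that place is arbitrary, and the bits of [c] on
    its two sides vary independently above those of [b]. *)
Lemma zeta_true_cuts (V : zmodType) (h : seq bool -> seq bool -> V) b :
  zeta (true_cuts h) b =
  all_cuts (fun u v => zeta (fun u' => zeta (h u') v) u) b.
Proof.
elim: b h => [|[] b IH] h //=.
  by rewrite zetaD (IH (fun u => h (true :: u))).
rewrite zetaD (IH (fun u => h (true :: u))) (IH (fun u => h (false :: u))).
by rewrite all_cutsD addrCA.
Qed.

Lemma all_cutsE (V : zmodType) (h : seq bool -> seq bool -> V) b :
  all_cuts h b = \sum_(i <- iota 0 (size b)) h (take i b) (drop i.+1 b).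
Proof.
elim: b h => [|x b IH] h /=; first by rewrite big_nil.
by rewrite big_cons (iotaDl 1 0) big_map IH /= drop0.
Qed.

(* A bit [true] closes the current part, which is [k] so far. *)
Fixpoint comp_from (k : nat) (b : seq bool) : word :=
  match b with
  | [::] => [:: k]
  | true :: b' => k :: comp_from 1 b'
  | false :: b' => comp_from k.+1 b'
  end.

Definition comp_of_bits := comp_from 1.

Definition word_cuts (V : zmodType) (g : word -> word -> V) (c : word) : V :=
  \sum_(i <- iota 0 (size c).+1) g (take i c) (drop i c).

Lemma word_cuts_cons (V : zmodType) (g : word -> word -> V) x c :
  word_cuts g (x :: c) = g [::] (x :: c) + word_cuts (fun u => g (x :: u)) c.
Proof.
rewrite /word_cuts -[iota 0 _]/(0%N :: iota 1 (size c).+1) big_cons.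
by rewrite (iotaDl 1 0) big_map.
Qed.

(** The two extreme cuts are separated from the inner ones. After an inner cut the right factor
    starts with a fresh part, hence [comp_of_bits], whereas the left one keeps the open part [k]. *)
Lemma word_cuts_comp_from (V : zmodType) (g : word -> word -> V) k b :
  word_cuts g (comp_from k b) =
  g [::] (comp_from k b) + g (comp_from k b) [::] +
  true_cuts (fun u v => g (comp_from k u) (comp_of_bits v)) b.
Proof.
elim: b g k => [|[] b IH] g k /=.
- by rewrite word_cuts_cons /word_cuts big_seq1 addr0.
- rewrite word_cuts_cons (IH (fun u => g (k :: u))) -!addrA.
  by congr (_ + _); rewrite addrCA.
- exact: IH.
Qed.

(** * Compositions and descents *)

(** Generalised for induction: [a] is the last cut point passed and [k] the length of the open part,
    so [a + k] is the next candidate cut point. *)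
Lemma comp_maskE a k b :
  [seq (p.2 - p.1)%N |
     p <- zip (a :: mask b (iota (a + k)%N (size b)))
              (rcons (mask b (iota (a + k)%N (size b))) (a + k + size b)%N)] =
  comp_from k b.
Proof.
elim: b a k => [|[] b IH] a k /=.
- by congr (_ :: _); lia.
- congr (_ :: _); first by lia.
  by rewrite -(IH (a + k)%N 1%N) !addnS addn0 addSn.
- by rewrite -(IH a) !addnS !addSn.
Qed.

Lemma comp_mask b :
  Defs.comp (size b).+1 (mask b (iota 1 (size b))) = comp_of_bits b.
Proof. exact: (comp_maskE 0 1). Qed.

Lemma psums_cons x c : psums (x :: c) = x :: [seq (x + y)%N | y <- psums c].
Proof.
rewrite /psums /= take0 /= addn0 (iotaDl 1 1) -!map_comp; congr (_ :: _).
Qed.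

Lemma psums_comp_from k b :
  psums (comp_from k b) = rcons (mask b (iota k (size b))) (k + size b)%N.
Proof.
elim: b k => [|[] b IH] k /=.
- by rewrite /psums /= !addn0.
- rewrite psums_cons IH map_rcons map_mask -iotaDl addn1.
  by rewrite add1n.
- by rewrite IH addSnnS.
Qed.

Lemma sumn_comp_from k b : sumn (comp_from k b) = (k + size b)%N.
Proof.
by elim: b k => [|[] b IH] k /=; rewrite ?IH ?addSnnS ?add1n.
Qed.

(** Since the entries are distinct, whether an entry selected by [b] is also selected by [c] depends
    on its own bit alone. [N] stands for the total, which is the last partial sum on both sides. *)
Lemma mask_subset_implb (I : seq nat) N b c :
  uniq (rcons I N) -> size b = size I -> size c = size I ->
  all (fun d => d \in rcons (mask c I) N) (rcons (mask b I) N) = all2 implb b c.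
Proof.
elim: I b c => [|x I IH] [|y b] [|z c] //=; first by rewrite mem_head.
case/andP=> xI uI [sb] [sc].
have xc : x \in rcons (mask c I) N = false.
  apply: contraNF xI; rewrite !mem_rcons !inE => /orP[->//|/mem_mask->].
  by rewrite orbT.
(* No later entry equals [x], so selecting or omitting [x] does not affect their membership. *)
have eqm : {in rcons (mask b I) N,
    (fun d => d \in rcons (mask (z :: c) (x :: I)) N) =1
    (fun d => d \in rcons (mask c I) N)}.
  move=> d db; case: z => //=; rewrite inE.
  case: eqP => // dx; move: db xI; rewrite dx !mem_rcons !inE.
  by case/orP=> [->//|/mem_mask->]; rewrite orbT.
rewrite -(IH b c) //; case: y => /=; last exact: eq_in_all.
rewrite (eq_in_all eqm); congr (_ && _).
by case: z {eqm} => /=; rewrite ?inE ?eqxx ?xc.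
Qed.

Lemma refines_comp_of_bits b c :
  size b = size c -> refines (comp_of_bits c) (comp_of_bits b) = all2 implb b c.
Proof.
move=> sbc; rewrite /refines /comp_of_bits !sumn_comp_from sbc eqxx /=.
rewrite !psums_comp_from sbc mask_subset_implb ?size_iota //.
by rewrite -cats1 -(iotaD 1 (size c) 1) iota_uniq.
Qed.

Fixpoint bitseqs n : seq (seq bool) :=
  if n is n'.+1 then map (cons false) (bitseqs n') ++ map (cons true) (bitseqs n')
  else [:: [::]].

Lemma size_bitseqs n : {in bitseqs n, forall b, size b = n}.
Proof.
elim: n => [|n IH] b /=; first by rewrite inE => /eqP->.
by rewrite mem_cat => /orP[] /mapP[c /IH <- ->].
Qed.

Lemma sublistsE s : sublists s = [seq mask b s | b <- bitseqs (size s)].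
Proof.
by elim: s => [|x s IH] //=; rewrite IH map_cat -!map_comp.
Qed.

Lemma zetaE (V : zmodType) (g : seq bool -> V) b :
  zeta g b = \sum_(c <- bitseqs (size b) | all2 implb b c) g c.
Proof.
elim: b g => [|x b IH] g /=; first by rewrite big_cons big_nil /= addr0.
rewrite big_cat !big_map /=; case: x => /=; rewrite !IH //.
by rewrite big_pred0_eq add0r.
Qed.

Lemma Ffun_comp_of_bits b :
  Ffun (comp_of_bits b) = zeta (fun c => << comp_of_bits c >> : FA) b.
Proof.
rewrite /Ffun sumn_comp_from add1n succnK sublistsE size_iota big_map zetaE.
rewrite big_seq_cond [RHS]big_seq_cond; apply: eq_big => [c|c /andP[/size_bitseqs sc _]].
  case: (boolP (c \in _)) => // /size_bitseqs sc.
  by rewrite !andTb -sc comp_mask refines_comp_of_bits.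
by rewrite -sc comp_mask.
Qed.

Definition descent_bits (s : word) : seq bool :=
  [seq (nth 0 s i < nth 0 s i.-1)%N | i <- iota 1 (size s).-1].

Lemma size_descent_bits s : size (descent_bits s) = (size s).-1.
Proof. by rewrite size_map size_iota. Qed.

Lemma nth_descent_bits s i : (i.+1 < size s)%N ->
  nth false (descent_bits s) i = (nth 0 s i.+1 < nth 0 s i)%N.
Proof. by move=> si; rewrite (nth_map 0) ?nth_iota ?size_iota //; lia. Qed.

Lemma desc_maskE s :
  desc s = mask (descent_bits s) (iota 1 (size s).-1).
Proof. exact: filter_mask. Qed.

Lemma descent_bits_map (f : nat -> nat) (s : word) :
  {in s &, forall x y, (f x < f y)%N = (x < y)%N} ->
  descent_bits (map f s) = descent_bits s.
Proof.
move=> fmono; rewrite /descent_bits size_map; apply/eq_in_map => i.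
rewrite mem_iota add1n; case: i => // i /= lti.
have lt1 : (i.+1 < size s)%N by case: (size s) lti.
have lt2 : (i < size s)%N := ltnW lt1.
by rewrite !(nth_map 0) // fmono ?mem_nth.
Qed.

Lemma count_ltn (T : eqType) (P Q : pred T) (s : seq T) y :
  subpred P Q -> y \in s -> ~~ P y -> Q y -> (count P s < count Q s)%N.
Proof.
move=> PQ ys Py Qy; elim: s ys => //= x s IH.
rewrite inE => /orP[/eqP<-|/IH lts].
  by rewrite (negbTE Py) Qy add0n add1n ltnS sub_count.
by rewrite -addnS leq_add //; case: (boolP (P x)) => // /PQ ->.
Qed.

Lemma st_mono (a : word) :
  {in a &, forall x y,
     (count (fun z => z <= x) a < count (fun z => z <= y) a)%N = (x < y)%N}.
Proof.
move=> x y xa ya; case: (ltnP x y) => xy.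
  apply: (@count_ltn _ _ _ _ y) => //= [z zx|]; last by rewrite -ltnNge.
  exact: leq_trans zx (ltnW xy).
by apply/negbTE; rewrite -leqNgt; apply: sub_count => z /= /leq_trans; apply.
Qed.

Lemma descent_bits_st a : descent_bits (st a) = descent_bits a.
Proof. by apply: descent_bits_map => x y xa ya; apply: st_mono. Qed.

(** The first [i.+1] letters have [i] adjacent pairs. Together with [descent_bits_drop] at [i.+1],
    this shows that cutting after these letters loses exactly bit [i], as in [all_cuts]. *)
Lemma descent_bits_take i s :
  descent_bits (take i.+1 s) = take i (descent_bits s).
Proof.
apply: (@eq_from_nth _ false).
  by rewrite size_take_min !size_descent_bits size_take_min; lia.
move=> j; rewrite size_descent_bits size_take_min => jlt.
rewrite nth_take ?nth_descent_bits ?size_take_min ?nth_take //; lia.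
Qed.

Lemma descent_bits_drop i s :
  descent_bits (drop i s) = drop i (descent_bits s).
Proof.
apply: (@eq_from_nth _ false).
  by rewrite size_drop !size_descent_bits size_drop; lia.
move=> j; rewrite size_descent_bits size_drop => jlt.
by rewrite nth_drop !nth_descent_bits ?size_drop ?nth_drop ?addnS //; lia.
Qed.

(** * [pi] on basis words and its compatibility with counit and comultiplication *)

Lemma pi_basis_nil : pi_basis [::] = << [::] >>.
Proof. by rewrite /pi_basis /Ffun /= unlock /= addr0. Qed.

(** The empty word is excluded because the empty bit sequence already encodes the composition
    [[:: 1]]. *)
Lemma pi_basisE w : w != [::] ->
  pi_basis w = zeta (fun c => << comp_of_bits c >> : FA) (descent_bits w).
Proof.
case: w => // x w _; rewrite -Ffun_comp_of_bits -comp_mask.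
by rewrite size_descent_bits /= /pi_basis desc_maskE.
Qed.

Lemma comp_from_neq_nil k b : (comp_from k b == [::]) = false.
Proof. by elim: b k => [|[] b IH] k /=. Qed.

Lemma is_comp_comp_from k b : is_comp (comp_from k.+1 b).
Proof. by elim: b k => [|[] b IH] k //=; apply: IH. Qed.

Lemma supported_zeta (K : choiceType) (P : pred K)
    (g : seq bool -> {freeg K / int}) b :
  (forall c, supported P (g c)) -> supported P (zeta g b).
Proof.
elim: b g => [|[] b IH] g Pg //=; first exact: IH.
by apply: supportedD; apply: IH.
Qed.

Lemma supported_moebius (K : choiceType) (P : pred K)
    (g : seq bool -> {freeg K / int}) b :
  (forall c, supported P (g c)) -> supported P (moebius g b).
Proof.
elim: b g => [|[] b IH] g Pg //=; first exact: IH.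
by apply: supportedB; apply: IH.
Qed.

Lemma pi_basis_in_QSymm w : in_QSymm (pi_basis w).
Proof.
have [->|w0] := eqVneq w [::]; first by rewrite pi_basis_nil /in_QSymm domU1.
rewrite pi_basisE //; apply: supported_zeta => c.
by rewrite supported1 is_comp_comp_from.
Qed.

Lemma eps_pi_basis w : eps (pi_basis w) = (w == [::])%:R.
Proof.
have [->|w0] := eqVneq w [::]; first by rewrite pi_basis_nil /eps fglift1.
rewrite pi_basisE // (raddf_zeta eps) /=.
rewrite (@eq_zeta _ _ (fun _ => 0)) => [|c].
  by elim: (descent_bits w) => [|[] b IH] //=; rewrite IH ?addr0.
by rewrite /eps fglift1 comp_from_neq_nil.
Qed.

Lemma tens_zeta (g h : seq bool -> FA) u v :
  tens (zeta g u) (zeta h v) = zeta (fun u' => zeta (fun v' => tens (g u') (h v')) v) u.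
Proof.
rewrite -/(tensr (zeta h v) (zeta g u)) (raddf_zeta (tensr _)).
by apply: eq_zeta => u'; rewrite /= /tensr (raddf_zeta (tens (g u'))).
Qed.

(** Inverse to [comp_of_bits] on nonempty compositions. A part [k] gives [k.-1] bits [false], and
    only a part followed by another one is closed by [true]. *)
Fixpoint bits_of_comp (c : word) : seq bool :=
  if c is k :: c' then
    nseq k.-1 false ++ (if c' is [::] then [::] else true :: bits_of_comp c')
  else [::].

Lemma comp_from_nseq k m b :
  comp_from k (nseq m false ++ b) = comp_from (k + m) b.
Proof. by elim: m k => [|m IH] k /=; rewrite ?addn0 // IH addSnnS. Qed.

Lemma bits_of_compK c :
  c != [::] -> is_comp c -> comp_of_bits (bits_of_comp c) = c.
Proof.
elim: c => // k c IH _ /andP[k0 cc]; rewrite /comp_of_bits /= comp_from_nseq.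
rewrite add1n prednK //; case: c IH cc => //= k' c IH cc.
by congr (_ :: _); apply: IH.
Qed.

Lemma comp_fromK k b : bits_of_comp (comp_from k.+1 b) = nseq k false ++ b.
Proof.
elim: b k => [|[] b IH] k /=; first by [].
  case E: (comp_from 1 b) (comp_from_neq_nil 1 b) => [//|x c] _.
  by rewrite -E IH.
by rewrite IH; elim: k => //= k ->.
Qed.

Lemma comp_of_bitsK b : bits_of_comp (comp_of_bits b) = b.
Proof. exact: (comp_fromK 0). Qed.

Lemma size_st a : size (st a) = size a.
Proof. exact: size_map. Qed.

Lemma pi_basis_st a : pi_basis (st a) = pi_basis a.
Proof.
by rewrite /pi_basis !desc_maskE descent_bits_st size_st.
Qed.

Lemma pipi_muM_basis w :
  pipi (muM_basis w) = word_cuts (fun u v => tens (pi_basis u) (pi_basis v)) w.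
Proof.
rewrite /muM_basis raddf_sum; apply: eq_bigr => i _.
by rewrite /= /pipi fglift1 /= !pi_basis_st.
Qed.

(** For nonempty [w], each composition in the zeta sum is split into its two extreme cuts and its
    inner cuts. The extreme ones match the extreme cuts of [w], and [zeta_true_cuts] turns the inner
    ones into the inner cuts of [w]. *)
Lemma DeltaQ_pi_basis w : DeltaQ (pi_basis w) = pipi (muM_basis w).
Proof.
rewrite pipi_muM_basis; have [->|w0] := eqVneq w [::].
  by rewrite pi_basis_nil /DeltaQ fglift1 /word_cuts /DeltaQ_basis !big_seq1
    pi_basis_nil tens1.
rewrite {1}pi_basisE // (raddf_zeta DeltaQ).
pose g u v : FA2 := << (u, v) >>.
rewrite (@eq_zeta _ _ (fun c => g [::] (comp_of_bits c) + g (comp_of_bits c) [::] +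
  true_cuts (fun u v => g (comp_of_bits u) (comp_of_bits v)) c)); last first.
  by move=> c; rewrite /= /DeltaQ fglift1 -(word_cuts_comp_from g).
rewrite !zetaD zeta_true_cuts all_cutsE size_descent_bits /word_cuts.
case sw: (size w) => [|n]; first by move/size0nil: sw w0 => ->.
(* The cuts of [w] are at [0], at [1] to [n], and at [n.+1], the length of [w]. *)
rewrite -[iota 0 n.+2]/(0%N :: iota 1 n.+1) big_cons -addn1 iotaD big_cat /=.
rewrite big_seq1 take0 drop0 add1n -sw take_size drop_size pi_basis_nil.
rewrite -addrA; congr (_ + _).
  rewrite pi_basisE // (raddf_zeta (tens _)).
  by apply: eq_zeta => c; rewrite /= tens1.
rewrite addrC; congr (_ + _); last first.
  rewrite pi_basisE // -/(tensr _ _) (raddf_zeta (tensr _)).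
  by apply: eq_zeta => c; rewrite /= /tensr tens1.
(* Bit [i] lies between letters [i] and [i.+1], counted from zero, so it matches the cut at [i.+1].
   For [i < n] both factors are nonempty and [pi_basisE] applies. *)
rewrite (iotaDl 1 0) big_map addn1; apply: eq_big_seq => i.
rewrite mem_iota /= add0n add1n => lti.
rewrite !pi_basisE ?descent_bits_take ?descent_bits_drop.
- rewrite tens_zeta; apply: eq_zeta => u; apply: eq_zeta => v.
  by rewrite tens1.
- by rewrite -size_eq0 size_drop sw; lia.
- by rewrite -size_eq0 size_take_min sw; lia.
Qed.

(** * Layered permutation words *)

(* Equivalently, the standardization of [s] is a direct sum of decreasing words. *)
Definition layered (s : word) : Prop :=
  forall i k j, (i <= k < j)%N -> (j < size s)%N ->
    (nth 0 s j < nth 0 s i)%N -> (nth 0 s k.+1 < nth 0 s k)%N.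

Lemma layered_take n s : layered s -> layered (take n s).
Proof.
move=> Ls i k j ikj; rewrite size_take_min => jlt.
by rewrite !nth_take; [apply: Ls => //; lia|lia..].
Qed.

Lemma layered_drop n s : layered s -> layered (drop n s).
Proof.
move=> Ls i k j ikj; rewrite size_drop => jlt.
rewrite !nth_drop addnS; apply: Ls; lia.
Qed.

Lemma layered_map (f : nat -> nat) (s : word) :
  {in s &, forall x y, (f x < f y)%N = (x < y)%N} -> layered s ->
  layered (map f s).
Proof.
move=> fmono Ls i k j ikj; rewrite size_map => jlt.
have fE m m' : (m <= j)%N -> (m' <= j)%N ->
    (nth 0 (map f s) m < nth 0 (map f s) m')%N = (nth 0 s m < nth 0 s m')%N.
  move=> mj m'j; have ms := leq_ltn_trans mj jlt; have m's := leq_ltn_trans m'j jlt.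
  by rewrite !(nth_map 0) // fmono ?mem_nth.
case/andP: (ikj) => ik kj; rewrite (fE j i) ?(fE k.+1 k) //.
- exact: Ls.
- exact: ltnW.
- exact: leq_trans ik (ltnW kj).
Qed.

Lemma layered_st s : layered s -> layered (st s).
Proof. by apply: layered_map => x y xs ys; apply: st_mono. Qed.

(** Pigeonhole: the counts are pairwise distinct and lie between [1] and [size a]. *)
Lemma is_permword_st a : uniq a -> is_permword (st a).
Proof.
move=> ua; rewrite /is_permword size_st.
have ust : uniq (st a).
  rewrite map_inj_in_uniq // => x y xa ya exy.
  have := st_mono xa ya; have := st_mono ya xa; rewrite exy !ltnn.
  by case: ltngtP.
have sub : {subset st a <= iota 1 (size a)}.
  move=> _ /mapP[x xa ->]; rewrite mem_iota add1n ltnS count_size andbT.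
  by rewrite -has_count; apply/hasP; exists x => /=.
apply: uniq_perm; rewrite ?iota_uniq //.
have [] // := uniq_min_size ust sub.
by rewrite size_st size_iota.
Qed.

Lemma count_leq_nth (P Q : pred nat) (s t : word) : size s = size t ->
  (forall j, (j < size s)%N -> P (nth 0 s j) -> Q (nth 0 t j)) ->
  (count P s <= count Q t)%N.
Proof.
elim: s t => [|x s IH] [|y t] //= [sz] PQ; apply: leq_add.
  by have := PQ 0%N; case: (P x) => // /(_ isT isT) /= ->.
by apply: IH => // j; apply: (PQ j.+1).
Qed.

(* Inclusion of inversion sets (weak order) implies lexicographic order: at the
   first difference [x :: s] vs [y :: t] with [y < x], the letter [y] would make
   [x] the head of more inversions than [y]. *)
Lemma lexle_inversions (s t : word) : perm_eq s t ->
  (forall i j, (i < j < size s)%N ->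
     (nth 0 s j < nth 0 s i)%N -> (nth 0 t j < nth 0 t i)%N) ->
  lexle s t.
Proof.
elim: s t => [|x s IH] [|y t] //= pst; first by move/perm_size: pst.
move=> inv; case: (ltngtP x y) => //= [yx|exy]; last first.
  apply: IH => [|i j ij]; first by move: pst; rewrite exy perm_cons.
  by apply: (inv i.+1 j.+1).
have sz : size s = size t by move/perm_size: pst => [].
have le1 : (count (fun z => z < x) s <= count (fun z => z < y) t)%N.
  apply: count_leq_nth => // j js; exact: (inv 0 j.+1).
have ys : y \in s.
  have := mem_head y t; rewrite -(perm_mem pst) inE => /orP[/eqP eyx|//].
  by rewrite eyx ltnn in yx.
have : (count (fun z => z < y) s < count (fun z => z < x) s)%N.
  apply: (count_ltn _ ys) => //=; last by rewrite ltnn.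
  by move=> z zy; apply: ltn_trans yx.
have /permP/(_ (fun z => z < y)%N) /= := pst.
by rewrite ltnn ltnNge (ltnW yx) !add0n => ->; rewrite ltnNge le1.
Qed.

Lemma lexle_anti s t : lexle s t -> lexle t s -> s = t.
Proof.
elim: s t => [|x s IH] [|y t] //=.
by case: ltngtP => //= -> st ts; rewrite (IH t).
Qed.

Lemma mem_desc k s :
  (k.+1 \in desc s) = (k.+1 < size s)%N && (nth 0 s k.+1 < nth 0 s k)%N.
Proof.
rewrite mem_filter mem_iota andbC /=; congr (_ && _).
by case: (size s).
Qed.

Lemma layered_lsd s : is_permword s -> layered s -> lsd s.
Proof.
move=> ps Ls; rewrite /lsd ps; apply/allP => t.
rewrite mem_permutations => pt; apply/implyP => /eqP dts.
have pts : perm_eq s t by rewrite (perm_trans ps) // perm_sym.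
have sz := perm_size pts; apply: lexle_inversions => // i j /andP[ij js] inv.
(* Layeredness gives [s] a descent at every position between [i] and [j], and [t] has the same
   descents. The induction below chains them into an inversion of [t]. *)
have desc_t k : (i <= k < j)%N -> (nth 0 t k.+1 < nth 0 t k)%N.
  move=> ikj; have := mem_desc k t; rewrite dts mem_desc -sz.
  rewrite (Ls i k j) // andbT; case/andP: ikj => _ kj.
  by rewrite (leq_ltn_trans kj js).
elim: j ij {js inv} desc_t => // j IH; rewrite ltnS leq_eqVlt => /orP[/eqP->|ij] H.
  by apply: H; rewrite !leqnn.
apply: (@ltn_trans (nth 0 t j)); first by apply: H; rewrite (ltnW ij) ltnSn.
by apply: IH => // k /andP[ik kj]; apply: H; rewrite ik ltnW.
Qed.

(* Prepending a letter just above the head creates a descent into the first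
   decreasing run; prepending a minimum creates an ascent. *)
Fixpoint layered_word (b : seq bool) : word :=
  match b with
  | [::] => [:: 0]
  | true :: b' => (head 0 (layered_word b')).*2.+1 :: map double (layered_word b')
  | false :: b' => 0 :: map succn (layered_word b')
  end.

Lemma size_layered_word b : size (layered_word b) = (size b).+1.
Proof. by elim: b => [|[] b IH] //=; rewrite size_map IH. Qed.

Lemma uniq_layered_word b : uniq (layered_word b).
Proof.
elim: b => [|[] b IH] //=; rewrite map_inj_uniq ?IH ?andbT //.
- by apply/mapP => -[x _ /(congr1 odd)]; rewrite /= !odd_double.
- exact: double_inj.
- by apply/mapP => -[x].
- exact: succn_inj.
Qed.

Lemma descent_bits_cons x y s :
  descent_bits (x :: y :: s) = (y < x)%N :: descent_bits (y :: s).
Proof.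
rewrite /descent_bits /= (iotaDl 1 1) -map_comp; congr (_ :: _).
by apply/eq_in_map => i; rewrite mem_iota => /andP[]; case: i.
Qed.

Lemma descent_bits_layered_word b : descent_bits (layered_word b) = b.
Proof.
elim: b => [|x b IH] //; have sz := size_layered_word b.
case: x => /=; case E: (layered_word b) sz IH => [//|y s] _ IH /=;
  rewrite descent_bits_cons.
  rewrite ltnS leqnn -map_cons descent_bits_map ?IH // => u v _ _.
  by rewrite ltn_double.
by rewrite ltn0 -map_cons descent_bits_map ?IH.
Qed.

Lemma layered_layered_word b : layered (layered_word b).
Proof.
elim: b => [|x b IH]; first by move=> i k [|j] //; rewrite andbF.
have mono2 : {in layered_word b &, forall u v, (u.*2 < v.*2)%N = (u < v)%N}.
  by move=> u v _ _; rewrite ltn_double.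
have monoS : {in layered_word b &, forall u v, (u.+1 < v.+1)%N = (u < v)%N}.
  by move=> u v _ _.
(* A new minimum starts no inversion, and inversions away from the head come from the tail by a
   monotone relabelling. What remains is an inversion starting at the head of a [true] step. *)
case: x => -[|i] k [|j]; rewrite ?andbF //= ltnS size_map => kj jlt.
- rewrite (nth_map 0) // => lt_head; case: k kj => [_|k kj] /=.
    by rewrite (nth_map 0) ?nth0 ?size_layered_word.
  have k1 : (k.+1 < size (layered_word b))%N := leq_ltn_trans kj jlt.
  have k0 := ltnW k1; rewrite !(nth_map 0) // ltn_double.
  apply: (IH 0%N k j) => //.
  (* The new head is one more than twice the old one, so [lt_head] only says that entry [j] is at
     most the old head. Strictness follows from distinctness of letters, since [j] is positive
     here. *)
  rewrite nth0 ltn_neqAle -leq_double -ltnS lt_head andbT -nth0.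
  rewrite nth_uniq ?uniq_layered_word // ?size_layered_word //.
  by rewrite -lt0n (leq_ltn_trans _ kj).
- case: k kj => // k kj lt_ij; apply: (layered_map mono2 IH kj) => //.
  by rewrite size_map.
- case: k kj => // k kj lt_ij; apply: (layered_map monoS IH kj) => //.
  by rewrite size_map.
Qed.

(** * Classification of the lsd words by their descents *)

Definition lsd_word (b : seq bool) : word := st (layered_word b).

Lemma size_lsd_word b : size (lsd_word b) = (size b).+1.
Proof. by rewrite size_st size_layered_word. Qed.

Lemma lsd_word_neq_nil b : (lsd_word b == [::]) = false.
Proof. by rewrite -size_eq0 size_lsd_word. Qed.

Lemma is_permword_lsd_word b : is_permword (lsd_word b).
Proof. by rewrite is_permword_st ?uniq_layered_word. Qed.

Lemma layered_lsd_word b : layered (lsd_word b).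
Proof. exact/layered_st/layered_layered_word. Qed.

Lemma lsd_lsd_word b : lsd (lsd_word b).
Proof.
apply: layered_lsd; [exact: is_permword_lsd_word | exact: layered_lsd_word].
Qed.

Lemma descent_bits_lsd_word b : descent_bits (lsd_word b) = b.
Proof. by rewrite descent_bits_st descent_bits_layered_word. Qed.

(** Both words are lexicographically smallest among the permutation words with this descent set, and
    the order is antisymmetric. *)
Lemma lsd_wordE s : s != [::] -> lsd s -> s = lsd_word (descent_bits s).
Proof.
move=> s0 /andP[ps /allP min_s]; set L := lsd_word _.
have sz : size L = size s.
  by rewrite size_lsd_word size_descent_bits prednK // lt0n size_eq0.
have dL : desc L = desc s by rewrite !desc_maskE descent_bits_lsd_word sz.
apply: lexle_anti.
  have := min_s L; rewrite mem_permutations -sz => /(_ (is_permword_lsd_word _)).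
  by rewrite dL eqxx.
have /andP[_ /allP/(_ s)] := lsd_lsd_word (descent_bits s).
by rewrite -/L mem_permutations sz => /(_ ps); rewrite dL eqxx.
Qed.

(** That a nonempty lsd word is layered needs no direct argument: by uniqueness it is the layered
    word constructed from its descents. *)
Lemma lsdP s : lsd s <-> is_permword s /\ layered s.
Proof.
split=> [ls|[]]; last exact: layered_lsd.
split; first by case/andP: ls.
have [->|s0] := eqVneq s [::]; first by [].
by rewrite (lsd_wordE s0 ls); apply: layered_lsd_word.
Qed.

Lemma uniq_permword s : is_permword s -> uniq s.
Proof. by move/perm_uniq->; apply: iota_uniq. Qed.

Lemma lsd_st_take i s : lsd s -> lsd (st (take i s)).
Proof.
move=> /lsdP[ps Ls]; apply/lsdP; split.
  by apply: is_permword_st; rewrite take_uniq ?uniq_permword.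
exact/layered_st/layered_take.
Qed.

Lemma lsd_st_drop i s : lsd s -> lsd (st (drop i s)).
Proof.
move=> /lsdP[ps Ls]; apply/lsdP; split.
  by apply: is_permword_st; rewrite drop_uniq ?uniq_permword.
exact/layered_st/layered_drop.
Qed.

Lemma muM_in_MPRlsd2 x : in_MPRlsd x -> in_MPRlsd2 (muM x).
Proof.
move=> /allP lx; apply: supported_fglift => w /lx lw.
apply: supported_sum => i _.
by rewrite supported1 /= lsd_st_take ?lsd_st_drop.
Qed.

(** * The section *)

(** Moebius inversion writes [c] as a signed sum of functions F; each F is replaced by the lsd word
    with the corresponding descents. The empty composition is treated apart because [bits_of_comp]
    does not distinguish it from [[:: 1]]. *)
Definition section_basis (c : word) : FA :=
  if c == [::] then << [::] >>
  else moebius (fun b => << lsd_word b >> : FA) (bits_of_comp c).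

Definition section (y : FA) : FA := fglift section_basis y.

HB.instance Definition _ :=
  GRing.isZmodMorphism.Build FA FA section (lift_is_additive section_basis).

Lemma section_comp_of_bits b :
  section << comp_of_bits b >> = moebius (fun b' => << lsd_word b' >> : FA) b.
Proof.
by rewrite /section fglift1 /section_basis comp_from_neq_nil comp_of_bitsK.
Qed.

(** Applying [section] termwise to the zeta sum gives the zeta transform of a Moebius transform, so
    only the lsd word with the descents of [w] survives, and this is [w]. *)
Lemma section_pi_basis w : lsd w -> section (pi_basis w) = << w >>.
Proof.
have [->|w0] := eqVneq w [::].
  by rewrite pi_basis_nil /section fglift1.
move=> lw; rewrite pi_basisE // (raddf_zeta section).
rewrite (eq_zeta section_comp_of_bits) zeta_moebius.
by rewrite -lsd_wordE.
Qed.

Lemma piM_section_basis c : is_comp c -> piM (section_basis c) = << c >>.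
Proof.
rewrite /section_basis; have [->|c0] := eqVneq c [::].
  by rewrite /piM fglift1 pi_basis_nil.
move=> cc; rewrite (raddf_moebius piM).
rewrite (eq_moebius (h := zeta (fun b => << comp_of_bits b >> : FA))).
  by rewrite moebius_zeta bits_of_compK.
move=> b; rewrite /= /piM fglift1 pi_basisE ?lsd_word_neq_nil //.
by rewrite descent_bits_lsd_word.
Qed.

Lemma piMK x : in_MPRlsd x -> section (piM x) = x.
Proof.
move=> /allP lx; rewrite /piM (raddf_fglift section) -[RHS]fglift_id.
by apply: eq_fglift_dom => w /lx /section_pi_basis.
Qed.

Lemma sectionK y : in_QSymm y -> piM (section y) = y.
Proof.
move=> /allP cy; rewrite /section (raddf_fglift piM) -[RHS]fglift_id.
by apply: eq_fglift_dom => c /cy /piM_section_basis.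
Qed.

Lemma section_in_MPRlsd y : in_MPRlsd (section y).
Proof.
apply: supported_fglift => c _; rewrite /section_basis; case: ifP => _.
  by rewrite supported1.
by apply: supported_moebius => b; rewrite supported1 lsd_lsd_word.
Qed.

Lemma piM_in_QSymm x : in_QSymm (piM x).
Proof. by apply: supported_fglift => w _; apply: pi_basis_in_QSymm. Qed.

Lemma DeltaQ_piM x : DeltaQ (piM x) = pipi (muM x).
Proof.
rewrite /piM (raddf_fglift DeltaQ) /muM (raddf_fglift pipi).
by apply: eq_fglift_dom => w _; apply: DeltaQ_pi_basis.
Qed.

Lemma eps_piM x : eps (piM x) = eps x.
Proof.
rewrite /piM (raddf_fglift eps).
by apply: (@eq_fglift_dom _ _ int^o) => w _; apply: eps_pi_basis.
Qed.

(** The tensor square of the left inverse property of [section]; it cancels [pipi] in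
    [muM_section]. *)
Lemma tens_map_pipi z : in_MPRlsd2 z -> tens_map section (pipi z) = z.
Proof.
move=> /allP lz; rewrite /pipi (raddf_fglift (tens_map section)) -[RHS]fglift_id.
apply: eq_fglift_dom => -[u v] /lz /andP[lu lv].
by rewrite /= (tens_map_tens section) /= !section_pi_basis // tens1.
Qed.

(** The inverse of a bijective coalgebra morphism is again one: write [y] as [piM (section y)], move
    the comultiplication through [piM], and cancel [pipi]. The cancellation is allowed because [muM]
    preserves the lsd span. *)
Lemma muM_section y :
  in_QSymm y -> muM (section y) = tens_map section (DeltaQ y).
Proof.
move=> cy; rewrite -{2}(sectionK cy) DeltaQ_piM tens_map_pipi //.
exact/muM_in_MPRlsd2/section_in_MPRlsd.
Qed.

Theorem theorem14p4 :
  (* MPR_lsd is a subcoalgebra: mu(MPR_lsd) in MPR_lsd (x) MPR_lsd *)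
  (forall x : FA, in_MPRlsd x -> in_MPRlsd2 (muM x)) /\
  (* pi'' = pi|MPR_lsd is a coalgebra morphism into QSymm *)
  (forall x : FA, in_MPRlsd x ->
     [/\ in_QSymm (piM x), DeltaQ (piM x) = pipi (muM x) & eps (piM x) = eps x]) /\
  (* pi'' is bijective onto QSymm *)
  (forall x y : FA, in_MPRlsd x -> in_MPRlsd y -> piM x = piM y -> x = y) /\
  (forall y : FA, in_QSymm y -> exists2 x : FA, in_MPRlsd x & piM x = y) /\
  (* consequently, its inverse is a coalgebra section of pi *)
  (exists s : {additive FA -> FA},
     forall y : FA, in_QSymm y ->
       [/\ in_MPRlsd (s y), piM (s y) = y,
           muM (s y) = tens_map s (DeltaQ y) & eps (s y) = eps y]).
Proof.
split; first exact: muM_in_MPRlsd2.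
split=> [x _|]; first by rewrite piM_in_QSymm DeltaQ_piM eps_piM.
split=> [x y lx ly /(congr1 section)|]; first by rewrite !piMK.
split=> [y cy|].
  by exists (section y); [apply: section_in_MPRlsd | apply: sectionK].
exists section => y cy; split.
- exact: section_in_MPRlsd.
- exact: sectionK.
- exact: muM_section.
- by rewrite -eps_piM sectionK.
Qed.
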